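(* Let $(\mathsf{Gen},\mathsf{Sign},\mathsf{Ver})$ be a one-time oracle signature scheme with perfect completeness in the random oracle model for a message space $\mathcal{M}$, in which the total number of oracle queries asked by $\mathsf{Gen}$, $\mathsf{Sign}$ and $\mathsf{Ver}$ is at most $q$. Let $\lambda,\delta>0$ and suppose $|\mathcal{M}|\ge \binom{q}{q/2}/\lambda$. Then there is a (computationally unbounded) adversary which asks at most $O\!\left(\frac{q^2\binom{q}{q/2}}{\lambda\delta^2}\right)=O\!\left(\frac{q^{1.5}2^q}{\lambda\delta^2}\right)$ oracle queries and breaks the scheme with probability $1-(\lambda+\delta)$, where this probability is over the randomness of the oracle, the coin tosses of the key generation algorithm, and the coin tosses of the adversary.
   Context: Random oracle: for each input length $\ell$, an independent uniformly random function $\{0,1\}^\ell\to\{0,1\}^\ell$, accessible only by queries. An oracle signature scheme with perfect completeness for $\mathcal{M}$ is a triple of oracle algorithms $(\mathsf{Gen},\mathsf{Sign},\mathsf{Ver})$ ($\mathsf{Gen}$ possibly probabilistic, outputting $(SK,VK)$) such that for every oracle $\mathcal{O}$, every $(SK,VK)$ output by $\mathsf{Gen}^{\mathcal{O}}$ with positive probability and every $\alpha\in\mathcal{M}$, $\mathsf{Ver}^{\mathcal{O}}(VK,\alpha,\mathsf{Sign}^{\mathcal{O}}(SK,\alpha))=1$. The total number of queries is counted over generating the keys, signing one message and verifying that signature. Breaking the (one-time) scheme: the adversary receives $VK$, chooses a message $\alpha\in\mathcal{M}$ (independently of $VK$), receives $\sigma=\mathsf{Sign}^{\mathcal{O}}(SK,\alpha)$,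 may query the oracle, and outputs $(\alpha^*,\sigma^* )$; it breaks the scheme if $\alpha^*\ne\alpha$ and $\mathsf{Ver}^{\mathcal{O}}(VK,\alpha^*,\sigma^* )=1$. Oracle queries made by the adversary include all queries it makes in any computation it performs. *)

(* Defs.v *)
From mathcomp Require Import all_boot all_order all_algebra.
From mathcomp Require Import all_classical all_reals all_analysis.

Set Implicit Arguments.
Unset Strict Implicit.
Unset Printing Implicit Defensive.

Import Order.TTheory GRing.Theory Num.Theory.

Local Open Scope classical_set_scope.
Local Open Scope ring_scope.

Definition oracle := forall l : nat, {ffun l.-tuple bool -> l.-tuple bool}.

(* Deterministic oracle algorithms: the oracle is reachable only through
   [Ask l x k], which submits x in {0,1}^l and continues with k on the answer.
   Between two queries the computation is unbounded; every run halts. Coin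
   tosses are passed as an extra argument of type [n.-tuple bool]. *)
Inductive oalg (A : Type) : Type :=
| Ret of A
| Ask (l : nat) (x : l.-tuple bool) of (l.-tuple bool -> oalg A).

Fixpoint run (A : Type) (O : oracle) (t : oalg A) : A :=
  match t with
  | Ret a => a
  | Ask l x k => run O (k (O l x))
  end.

(* Repeated queries are counted each time they are asked. *)
Fixpoint queries (A : Type) (O : oracle) (t : oalg A) : nat :=
  match t with
  | Ret _ => 0
  | Ask l x k => (queries O (k (O l x))).+1
  end.

Record sig_scheme (M SK VK Sig : Type) : Type := SigScheme {
  gen_coins : nat ;
  gen : gen_coins.-tuple bool -> oalg (SK * VK) ;
  sign : SK -> M -> oalg Sig ;
  ver : VK -> M -> Sig -> oalg bool
}.

(* The coins of Gen are uniform on the finite set {0,1}^gen_coins, so a pair of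
   keys has positive probability iff some coin string produces it. *)
Definition possible_keys (M SK VK Sig : Type) (S : sig_scheme M SK VK Sig)
    (O : oracle) (sk : SK) (vk : VK) : Prop :=
  exists r : (gen_coins S).-tuple bool, run O (gen r) = (sk, vk).

Definition perfectly_complete (M SK VK Sig : Type)
    (S : sig_scheme M SK VK Sig) : Prop :=
  forall (O : oracle) (sk : SK) (vk : VK) (m : M),
    possible_keys S O sk vk ->
    run O (ver S vk m (run O (sign S sk m))) = true.

Definition total_queries (M SK VK Sig : Type) (S : sig_scheme M SK VK Sig)
    (O : oracle) (r : (gen_coins S).-tuple bool) (m : M) : nat :=
  let: (sk, vk) := run O (gen r) in
  let: s := run O (sign S sk m) in
  (queries O (gen r) + queries O (sign S sk m) + queries O (ver S vk m s))%N.

(* [adv_msg] sees neither the verification key nor the oracle, so the message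
   submitted for signing is independent of both. The two phases share their
   coins, which lets [adv_forge] know that message. *)
Record adversary (M VK Sig : Type) : Type := Adversary {
  adv_coins : nat ;
  adv_msg : adv_coins.-tuple bool -> M ;
  adv_forge : adv_coins.-tuple bool -> VK -> Sig -> oalg (M * Sig)
}.

Definition breaks (M SK VK Sig : Type) (S : sig_scheme M SK VK Sig)
    (A : adversary M VK Sig) (O : oracle) (r : (gen_coins S).-tuple bool)
    (c : (adv_coins A).-tuple bool) : Prop :=
  let: (sk, vk) := run O (gen r) in
  let: m := adv_msg c in
  let: s := run O (sign S sk m) in
  let: (m', s') := run O (adv_forge c vk s) in
  m' <> m /\ run O (ver S vk m' s') = true.

(* On the probability space (Omega, P), the layers (O l)_l of the oracle and the
   two coin strings r and c form a mutually independent family, and each of them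
   is uniform on its finite range. *)
Definition random_oracle_and_coins (R : realType) (d : measure_display)
    (Omega : measurableType d) (P : probability Omega R) (n k : nat)
    (O : Omega -> oracle) (r : Omega -> n.-tuple bool)
    (c : Omega -> k.-tuple bool) : Prop :=
  [/\ forall (l : nat) (f : {ffun l.-tuple bool -> l.-tuple bool}),
        measurable [set w | O w l = f],
      forall u : n.-tuple bool, measurable [set w | r w = u],
      forall v : k.-tuple bool, measurable [set w | c w = v] &
      forall (ls : seq nat) (f : oracle) (u : n.-tuple bool)
             (v : k.-tuple bool), uniq ls ->
        P [set w | [/\ forall l, l \in ls -> O w l = f l, r w = u & c w = v]] =
        ((\prod_(l <- ls) (#|{ffun l.-tuple bool -> l.-tuple bool}|%:R)^-1)
          * (#|{: n.-tuple bool}|%:R)^-1 * (#|{: k.-tuple bool}|%:R)^-1)%:E].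

(* |T| >= x for a real x; T may be infinite. *)
Definition card_at_least (R : realType) (T : Type) (x : R) : Prop :=
  exists n : nat, x <= n%:R /\ (`I_n #<= [set: T])%card.

(* Main.v *)
Require Import Defs.
From mathcomp Require Import all_boot all_order all_algebra.
From mathcomp Require Import zify ring lra.
From mathcomp Require Import all_classical all_reals all_analysis.

Set Implicit Arguments.
Unset Strict Implicit.
Unset Printing Implicit Defensive.

Import Order.TTheory GRing.Theory Num.Theory.

(* Fix k = |M'| ~ binom(q, q/2) / lambda messages. For message i let V_i be the
   queries of verifying its signature and G, S_i those of key generation and of
   signing it. Call i stuck if V_j meets (G u S_i) \ V_i for every j <> i; by
   Bollobas' set-pairs inequality at most binom(q, q/2) messages are stuck, so
   some fixed i is stuck with probability at most lambda.

   Given the signature of i, the adversary asks every query that is still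
   uncertain and lies in G u S_i u V_i with conditional probability at least
   e = delta / (2k(q+1)); by a potential argument it is done after O(q/(e delta))
   queries except with probability delta/2. It then guesses a world w' consistent
   with its view, answers the queries of G u S_i as w' does and all others by the
   oracle, computes with the secret key of w' a signature of every other message,
   and outputs one that verifies under the real oracle.

   Let the true world w and w' be independent and uniform among the consistent
   worlds. Exchanging their answers outside the queries of either honest
   execution is an involution on pairs of consistent worlds, so the world w'' it
   makes of w' is again uniform. If i is not stuck in w'', completeness in w''
   gives a message j whose signature verifies in w'' and, its verification
   avoiding the queries on which w'' and the real oracle differ, also in reality;
   the exception is that w'' makes a query of w which is uncertain but light,
   which has probability at most kqe <= delta/2.

   The best i and, for each view, the best w' do at least as well as random ones,
   so the adversary needs no coins. *)

(** * Decision trees *)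

Definition query := {l : nat & l.-tuple bool}.

Definition ans (O : oracle) (z : query) : (tag z).-tuple bool := O (tag z) (tagged z).

Definition agree (s : seq query) (O O' : oracle) : Prop :=
  forall z, z \in s -> ans O' z = ans O z.

Fixpoint trace (A : Type) (O : oracle) (t : oalg A) : seq query :=
  match t with
  | Ret _ => [::]
  | Ask l x k => Tagged (fun l => l.-tuple bool) x :: trace O (k (O l x))
  end.

Lemma size_trace (A : Type) (O : oracle) (t : oalg A) :
  size (trace O t) = queries O t.
Proof. by elim: t => [a|l x k IH] //=; rewrite IH. Qed.

Lemma trace_agree (A : Type) (O O' : oracle) (t : oalg A) :
  agree (trace O t) O O' -> trace O' t = trace O t /\ run O' t = run O t.
Proof.
elim: t => [a|l x k IH] //= h.
have e : O' l x = O l x by apply: (h (Tagged _ x)); rewrite inE eqxx.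
rewrite e; have [z zin|-> ->] // := IH (O l x).
by apply: h; rewrite inE zin orbT.
Qed.

(* Oracles agreeing on K make the same queries up to the first one outside K. *)
Lemma trace_first_diff (A : Type) (K : query -> Prop) (O : oracle) (t : oalg A)
    (z : query) : z \in trace O t -> ~ K z ->
  exists2 z', ~ K z' & forall O', (forall y, K y -> ans O' y = ans O y) ->
    z' \in trace O' t.
Proof.
elim: t => [a|l x k IH] //= zin nK.
have [Kx|nKx] := pselect (K (Tagged (fun l => l.-tuple bool) x)); last first.
  by exists (Tagged _ x) => // O' _; rewrite inE eqxx.
move: zin; rewrite inE => /orP[/eqP zx|zin]; first by rewrite zx in nK.
have [z' nKz' h] := IH _ zin nK.
exists z' => // O' ag; rewrite inE (_ : O' l x = O l x) ?h ?orbT //.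
exact: (ag _ Kx).
Qed.

Fixpoint bind (A B : Type) (t : oalg A) (f : A -> oalg B) : oalg B :=
  match t with
  | Ret a => f a
  | Ask l x k => Ask x (fun y => bind (k y) f)
  end.

Lemma run_bind (A B : Type) (O : oracle) (t : oalg A) (f : A -> oalg B) :
  run O (bind t f) = run O (f (run O t)).
Proof. by elim: t => /=. Qed.

Lemma queries_bind (A B : Type) (O : oracle) (t : oalg A) (f : A -> oalg B) :
  queries O (bind t f) = (queries O t + queries O (f (run O t)))%N.
Proof. by elim: t => //= l x k ->. Qed.

Fixpoint truncate (A : Type) (n : nat) (t : oalg A) : oalg (option A) :=
  match t, n with
  | Ret a, _ => Ret (Some a)
  | Ask l x k, n'.+1 => Ask x (fun y => truncate n' (k y))
  | Ask _ _ _, 0 => Ret None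
  end.

Lemma queries_truncate (A : Type) (O : oracle) (n : nat) (t : oalg A) :
  (queries O (truncate n t) <= n)%N.
Proof. by elim: t n => [a|l x k IH] [|n] //=; apply: IH. Qed.

Lemma run_truncate (A : Type) (O : oracle) (n : nat) (t : oalg A) :
  run O (truncate n t) = if (queries O t <= n)%N then Some (run O t) else None.
Proof. by elim: t n => [a|l x k IH] [|n] //=; rewrite IH. Qed.

Definition splice (D : pred query) (O O1 : oracle) : oracle := fun l =>
  [ffun x => if D (Tagged (fun l => l.-tuple bool) x) then O1 l x else O l x].

Lemma ans_splice (D : pred query) (O O1 : oracle) (z : query) :
  ans (splice D O O1) z = if D z then ans O1 z else ans O z.
Proof. by case: z => l x; rewrite /ans ffunE. Qed.

Fixpoint simulate (A : Type) (D : pred query) (O1 : oracle) (t : oalg A) : oalg A :=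
  match t with
  | Ret a => Ret a
  | Ask l x k =>
      if D (Tagged (fun l => l.-tuple bool) x) then simulate D O1 (k (O1 l x))
      else Ask x (fun y => simulate D O1 (k y))
  end.

Lemma run_simulate (A : Type) (D : pred query) (O O1 : oracle) (t : oalg A) :
  run O (simulate D O1 t) = run (splice D O O1) t.
Proof.
by elim: t => //= l x k IH; rewrite ffunE; case: ifP => _ /=; apply: IH.
Qed.

Lemma queries_simulate (A : Type) (D : pred query) (O O1 : oracle) (t : oalg A) :
  (queries O (simulate D O1 t) <= queries (splice D O O1) t)%N.
Proof.
elim: t => //= l x k IH; rewrite ffunE; case: ifP => _ /=; last exact: IH.
exact: leqW.
Qed.

(* One more than the largest query length, so that 0 means no query. *)
Fixpoint max_length (A : Type) (t : oalg A) : nat :=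
  match t with
  | Ret _ => 0
  | Ask l x k => maxn l.+1 (\max_(y : l.-tuple bool) max_length (k y))
  end.

Lemma trace_max_length (A : Type) (O : oracle) (t : oalg A) (z : query) :
  z \in trace O t -> (tag z < max_length t)%N.
Proof.
elim: t => [a|l x k IH] //=; rewrite inE => /orP[/eqP->|/IH h].
  by rewrite leq_max leqnn.
rewrite leq_max; apply/orP; right; apply: (leq_trans h).
exact: (leq_bigmax (O l x)).
Qed.

Lemma max_length_bind (A B : Type) (O : oracle) (t : oalg A) (f : A -> oalg B) :
  (max_length t <= max_length (bind t f))%N /\
  (max_length (f (run O t)) <= max_length (bind t f))%N.
Proof.
elim: t => [a|l x k IH] //=; split.
  rewrite geq_max leq_maxl /=; apply: leq_trans (leq_maxr _ _).
  apply/bigmax_leqP => y _; apply: leq_trans (leq_bigmax y).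
  by have [] := IH y.
apply: leq_trans (leq_maxr _ _); apply: leq_trans (leq_bigmax (O l x)).
by have [] := IH (O l x).
Qed.

Lemma run_below (A : Type) (O O' : oracle) (L : nat) (t : oalg A) :
  (max_length t <= L)%N ->
  (forall z, (tag z < L)%N -> ans O' z = ans O z) -> run O' t = run O t.
Proof.
move=> tL h; apply: (trace_agree _).2 => z /trace_max_length zt.
exact/h/(leq_trans zt).
Qed.

Local Open Scope ring_scope.

(** * Set pairs and central binomial coefficients *)

Lemma bollobas (R : realFieldType) (T : eqType) (I : finType)
    (A B : I -> pred T) (s : seq T) (P : pred I) :
  uniq s ->
  (forall i x, P i -> x \in s -> A i x -> ~~ B i x) ->
  (forall i j, P i -> P j -> i != j -> has (predI (A i) (B j)) s) ->
  \sum_(i | P i) ('C(count (A i) s + count (B i) s, count (A i) s)%:R : R)^-1 <= 1.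
Proof.
have [n] := ubnP (size s); elim: n s P => // n IH s P ns us dAB xAB.
have [/existsP[i0 /andP[Pi0 /eqP Bi0]]|] :=
  boolP [exists i0, P i0 && (count (B i0) s == 0)%N].
  rewrite (bigD1 i0) //= big1 ?addr0 => [|i /andP[Pi ii0]].
    by rewrite Bi0 addn0 binn invr1.
  have := xAB _ _ Pi Pi0 ii0; rewrite has_count lt0n => /negP[].
  by rewrite -leqn0 -Bi0; apply/sub_count => x /andP[].
rewrite negb_exists => /forallP B0.
have [i1 Pi1|P0] := pickP P; last by rewrite big_pred0.
have b0 i : P i -> (0 < count (B i) s)%N.
  by move=> Pi; rewrite lt0n; have := B0 i; rewrite Pi.
have s0 : (0 < size s)%N by apply: leq_trans (b0 _ Pi1) (count_size _ _).
(* Deleting x from the ground set, and dropping the pairs whose first set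
   contains x, preserves the hypotheses; summing the resulting inequalities over
   all x gives each pair its original weight [size s] times. *)
pose F i x : R := ('C(count (A i) s + (count (B i) s - B i x),
  count (A i) s)%:R)^-1.
have Hx x : x \in s -> \sum_(i | P i && ~~ A i x) F i x <= 1.
  move=> xs; have := IH (rem x s) (fun i => P i && ~~ A i x).
  rewrite size_rem // -ltnS prednK // => /(_ ns (rem_uniq _ us)) IHx.
  apply: le_trans (IHx _ _); last first.
  - move=> i j /andP[Pi nAi] /andP[Pj _] ij.
    have /hasP[y ys /andP[/= Ay By]] := xAB _ _ Pi Pj ij.
    apply/hasP; exists y; last by apply/andP.
    by rewrite mem_rem_uniq // inE ys andbT; apply: contraNneq nAi => <-.
  - by move=> i y /andP[Pi _] /mem_rem ys; apply: dAB.
  apply: ler_sum => i /andP[Pi nAi].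
  have cr (Q : pred T) : count Q (rem x s) = (count Q s - Q x)%N.
    by rewrite (permP (perm_to_rem xs) Q) /= addKn.
  by rewrite !cr (negbTE nAi) subn0.
have Hs : \sum_(x <- s) \sum_(i | P i && ~~ A i x) F i x <= (size s)%:R.
  rewrite -sum1_size natr_sum [leLHS]big_seq [leRHS]big_seq.
  by apply: ler_sum => x xs; apply: Hx.
rewrite -(ler_pM2l (_ : 0 < (size s)%:R :> R)) ?ltr0n // mulr1.
apply: le_trans Hs; rewrite le_eqVlt; apply/orP; left; apply/eqP.
under [RHS]eq_bigr do rewrite big_mkcondr.
rewrite [RHS]exchange_big /= mulr_sumr; apply: eq_bigr => i Pi.
set a := count (A i) s; set b := count (B i) s.
have b_gt0 : (0 < b)%N := b0 _ Pi.
have cAB : (a + b + count (predC (predU (A i) (B i))) s)%N = size s.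
  rewrite -(count_predC (predU (A i) (B i)) s) /a /b -count_predUI.
  rewrite (_ : count (predI (A i) (B i)) s = 0)%N ?addn0 //.
  apply/eqP; rewrite -leqn0 leqNgt -has_count; apply/hasPn => x xs /=.
  by apply/negP => /andP[Ax]; apply/negP/(dAB _ _ Pi xs).
have -> : \sum_(x <- s) (if ~~ A i x then F i x else 0) =
    \sum_(x <- s | predC (predU (A i) (B i)) x) ('C(a + b, a)%:R)^-1 +
    \sum_(x <- s | B i x) ('C((a + b).-1, a)%:R)^-1.
  rewrite [X in X + _]big_mkcond [X in _ + X]big_mkcond -big_split /=.
  apply: eq_big_seq => x xs; rewrite /F -/a -/b.
  have := dAB _ _ Pi xs; case: (A i x) => /= [/(_ isT)/negbTE->|_].
    by rewrite addr0.
  case: (B i x) => /=; last by rewrite subn0 addr0.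
  by rewrite add0r addnBA // subn1.
rewrite !big_const_seq !iter_addr_0 -cAB natrD mulrDl mulr_natl addrC.
rewrite mulr_natl -[_ *+ b]mulr_natl; congr (_ + _).
have Cab := mul_bin_down (a + b) a; rewrite addKn in Cab.
apply/eqP; rewrite -mulr_natl eqr_div ?pnatr_eq0 -?lt0n ?bin_gt0 ?leq_addr //.
  by rewrite -!natrM Cab.
by rewrite -ltnS prednK ?addn_gt0 ?b_gt0 ?orbT // -addn1 leq_add2l.
Qed.

Lemma leq_bin_half (n k : nat) : ('C(n, k) <= 'C(n, n./2))%N.
Proof.
have low : forall j, (j <= n./2 -> 'C(n, n./2 - j) <= 'C(n, n./2))%N.
  elim=> [|j IH] jn; first by rewrite subn0.
  apply: leq_trans (IH (ltnW jn)); rewrite subnS.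
  set m := (n./2 - j).-1; have -> : (n./2 - j = m.+1)%N by rewrite prednK ?subn_gt0.
  have mn : (m.+1 <= n - m)%N by rewrite /m; lia.
  have nm0 : (0 < n - m)%N by apply: leq_trans mn.
  by rewrite -(leq_pmul2l nm0) -mul_bin_left leq_mul2r mn orbT.
have [kn|nk] := leqP k n./2; first by rewrite -(subKn kn) low ?leq_subr.
have [kn|/bin_small->//] := leqP k n.
by rewrite -bin_sub // -(subKn (_ : n - k <= n./2)%N) ?low ?leq_subr //; lia.
Qed.

Lemma leq_bin_half_trans (q n k : nat) : (n <= q -> 'C(n, k) <= 'C(q, q./2))%N.
Proof.
by move=> nq; apply: leq_trans (leq_bin_half q k); apply: leq_bin2l.
Qed.

Lemma bin_half_sqr (q : nat) : ('C(q, q./2) ^ 2 * q <= 4 ^ q)%N.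
Proof.
have even n : ('C(n.*2, n) ^ 2 * n.*2.+1 <= 16 ^ n)%N.
  elim: n => [|n IH]; first by rewrite bin0.
  have e : (n.+1 * 'C(n.+1.*2, n.+1) = 2 * n.*2.+1 * 'C(n.*2, n))%N.
    have e1 := mul_bin_diag n.+1.*2 n.
    have e2 := mul_bin_down n.*2.+1 n; rewrite /= in e1 e2.
    rewrite doubleS in e1 *; rewrite -e1 /=.
    have -> : (n.*2.+2 = 2 * n.+1)%N by lia.
    have : (n.*2.+1 - n = n.+1)%N by lia.
    by move=> e3; rewrite e3 in e2; rewrite -!mulnA e2.
  rewrite -(@leq_pmul2l (n.+1 ^ 2)) ?expn_gt0 // mulnA -expnMn e.
  rewrite !expnMn (expnS 16) doubleS -!mulnn.
  move: IH; rewrite -mulnn; move: ('C(_, _) * 'C(_, _))%N (16 ^ n)%N => c p IH.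
  apply: (@leq_trans (4 * (n.*2.+1 * n.*2.+3) * p)).
    have := leq_mul (leqnn (4 * (n.*2.+1 * n.*2.+3))) IH.
    by apply: leq_trans; rewrite leq_eqVlt; apply/orP; left; apply/eqP; lia.
  have: (n.*2.+1 * n.*2.+3 <= 4 * (n.+1 * n.+1))%N by rewrite -!muln2; lia.
  by move=> /(leq_mul (leqnn (4 * p))); lia.
have := odd_double_half q; move: (q./2) => n; case: (odd q) => <-.
  rewrite add1n.
  have e : (n.+1 * 'C(n.*2.+1, n) = n.*2.+1 * 'C(n.*2, n))%N.
    have := mul_bin_down n.*2.+1 n; rewrite /= => ->.
    by congr (_ * _)%N; lia.
  have e4 : (4 ^ n.*2.+1 = 4 * 16 ^ n)%N by rewrite expnS -mul2n expnM.
  rewrite -(@leq_pmul2l (n.+1 ^ 2)) ?expn_gt0 // mulnA -expnMn e e4 expnMn.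
  have := even n; rewrite -!mulnn; move: ('C(_, _) * 'C(_, _))%N (16 ^ n)%N => c p.
  move=> /(leq_mul (leqnn (n.*2.+1 * n.*2.+1))) h.
  have: (n.*2.+1 * n.*2.+1 <= 4 * (n.+1 * n.+1))%N by rewrite -!muln2; lia.
  move=> /(leq_mul (leqnn p)) h2.
  by apply: leq_trans (_ : n.*2.+1 * n.*2.+1 * p <= _)%N; lia.
rewrite add0n -[in leqRHS]mul2n expnM; apply: leq_trans (even n).
by rewrite leq_mul2l leqnSn orbT.
Qed.

(** * Finitely many worlds *)

Section Worlds.
Variables L n : nat.

Definition layers := {dffun forall l : 'I_L, {ffun l.-tuple bool -> l.-tuple bool}}.

(* Lengths from L on carry the identity, so that a world is a total oracle. *)
Definition extend (f : layers) : oracle := fun l =>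
  if @idP (l < L)%N is ReflectT h then f (Ordinal h) else [ffun x => x].

Definition layers_of (O : oracle) : layers := [ffun l : 'I_L => O l].

Lemma ans_extend_layers_of (O : oracle) (z : query) :
  ans (extend (layers_of O)) z = if (tag z < L)%N then ans O z else tagged z.
Proof.
rewrite /ans /extend; case: {-}_ / idP => h; rewrite ffunE.
  by rewrite ifT.
by rewrite ifF //; apply/negP.
Qed.

Lemma ans_extend (f : layers) (z : query) :
  (L <= tag z)%N -> ans (extend f) z = tagged z.
Proof.
rewrite /ans /extend => Lz; case: {-}_ / idP => h; last by rewrite ffunE.
by exfalso; move: h; rewrite ltnNge Lz.
Qed.

Lemma extend_inj (f g : layers) :
  (forall z, ans (extend f) z = ans (extend g) z) -> f = g.
Proof.
move=> fg; apply/ffunP => -[l lL]; apply/ffunP => x.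
have := fg (Tagged (fun l => l.-tuple bool) x); rewrite /ans /extend /=.
case: {-}_ / idP => // h; by rewrite (bool_irrelevance h lL).
Qed.

Definition world : finType := (layers * n.-tuple bool)%type.

Definition orc (w : world) : oracle := extend w.1.

Definition mix (D : pred query) (w w' : world) : world :=
  (layers_of (splice D (orc w) (orc w')), w'.2).

Lemma ans_mix (D : pred query) (w w' : world) (z : query) :
  ans (orc (mix D w w')) z = if D z then ans (orc w') z else ans (orc w) z.
Proof.
rewrite ans_extend_layers_of ans_splice; have [//|Lz] := ltnP.
by rewrite !ans_extend // if_same.
Qed.

Lemma world_ext (w w' : world) :
  w.2 = w'.2 -> (forall z, ans (orc w) z = ans (orc w') z) -> w = w'.
Proof.
by case: w w' => [f r] [f' r'] /= -> h; congr (_, _); apply: extend_inj.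
Qed.

End Worlds.

(** * Learning the likely queries *)

Section Learning.
Variables (R : realFieldType) (L n : nat).
Local Notation world := (world L n).
Variables (dom : world -> seq query) (e : R).
Implicit Types (C : {set world}) (w : world) (z : query).

(* C is the set of worlds consistent with the learner's view; a query may be
   known without having been asked. *)
Definition known C z : Prop :=
  forall w w', w \in C -> w' \in C -> ans (orc w) z = ans (orc w') z.

Definition asking C z : {set world} := [set w in C | z \in dom w].

Definition heavy C z : Prop := ~ known C z /\ e * #|C|%:R <= #|asking C z|%:R.

Definition light C : Prop := forall z, ~ heavy C z.

Definition slice C z (y : (tag z).-tuple bool) : {set world} :=
  [set w in C | ans (orc w) z == y].

Fixpoint learn (m : nat) C : oalg {set world} :=
  if m isn't m'.+1 then Ret C else
  match pselect (exists z, heavy C z) with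
  | left h => let z := projT1 (cid h) in
              Ask (tagged z) (fun y => learn m' (slice C y))
  | right _ => Ret C
  end.

Lemma queries_learn (m : nat) C (O : oracle) : (queries O (learn m C) <= m)%N.
Proof.
by elim: m C => [|m IH] C //=; case: pselect => //= h; rewrite ltnS IH.
Qed.

Lemma learn_mem (m : nat) C w : w \in C -> w \in run (orc w) (learn m C).
Proof.
elim: m C => [|m IH] C //= wC; case: pselect => //= h.
by apply: IH; rewrite inE wC /=; apply/eqP.
Qed.

Lemma learn_sub (m : nat) C (O : oracle) : run O (learn m C) \subset C.
Proof.
elim: m C => [|m IH] C //=; case: pselect => //= h.
apply: (fintype.subset_trans (IH _)); by apply/fintype.subsetP => w; rewrite inE => /andP[].
Qed.

Lemma learn_class (m : nat) C w w' :
  w' \in run (orc w) (learn m C) ->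
  run (orc w') (learn m C) = run (orc w) (learn m C).
Proof.
elim: m C => [|m IH] C //=; case: pselect => //= h w'C.
have := fintype.subsetP (learn_sub _ _ _) _ w'C; rewrite inE => /andP[_ /eqP e'].
by rewrite (_ : orc w' _ _ = orc w (tag (projT1 (cid h))) (tagged (projT1 (cid h)))) ?IH.
Qed.

Definition cylinder C : Prop := forall w w', w \in C -> w'.2 = w.2 ->
  agree (dom w) (orc w) (orc w') ->
  (forall z, known C z -> ans (orc w') z = ans (orc w) z) -> w' \in C.

Lemma known_sub C C' z : C' \subset C -> known C z -> known C' z.
Proof. by move=> /fintype.subsetP s kz w w' /s wC /s w'C; apply: kz. Qed.

Lemma slice_sub C z (y : (tag z).-tuple bool) : slice C y \subset C.
Proof. by apply/fintype.subsetP => w; rewrite inE => /andP[]. Qed.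

Lemma known_slice C z (y : (tag z).-tuple bool) : known (slice C y) z.
Proof.
by move=> w w'; rewrite !inE => /andP[_ /eqP ->] /andP[_ /eqP ->].
Qed.

Lemma learn_cylinder (m : nat) C (O : oracle) :
  cylinder C -> cylinder (run O (learn m C)).
Proof.
elim: m C => [|m IH] C //=; case: pselect => //= h cC; apply: IH.
move=> w w' wC e2 ag kn; have := wC; rewrite !inE => /andP[wC' /eqP <-].
rewrite (cC w) //=; first by apply/eqP; apply: kn; apply: known_slice.
by move=> z kz; apply: kn; apply: known_sub kz; apply: slice_sub.
Qed.

Definition unknown_dom C w : nat := count (fun z => `[< ~ known C z >]) (undup (dom w)).

Lemma sum_slice (F : world -> R) C z :
  \sum_(w in C) F w = \sum_(y : (tag z).-tuple bool) \sum_(w in slice C y) F w.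
Proof.
rewrite (partition_big (fun w => ans (orc w) z) xpredT) //=.
by apply: eq_bigr => y _; apply: eq_bigl => w; rewrite inE.
Qed.

Hypothesis e_gt0 : 0 < e.

Lemma learn_exhausts (m : nat) C :
  m.+1%:R * e * (\sum_(w in C) (`[< ~ light (run (orc w) (learn m C)) >] : nat)%:R)
  <= \sum_(w in C) (unknown_dom C w)%:R.
Proof.
have base C0 z : ~ known C0 z ->
    #|asking C0 z|%:R <= \sum_(w in C0) ((z \in dom w) : nat)%:R :> R.
  move=> _; rewrite -sum1_card natr_sum big_mkcond [leRHS]big_mkcond /=.
  by apply: ler_sum => w _; rewrite inE; case: (w \in C0) => //=; case: ifP.
elim: m C => [|m IH] C /=.
  have [lC|] := pselect (light C).
    rewrite big1 ?mulr0 ?sumr_ge0 // => w wC.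
    by rewrite (_ : `[< _ >] = false) //; apply/asboolP => /(_ lC).
  move=> nlC; have [z [nk hz]] : exists z, heavy C z.
    by apply: contrapT => nh; apply: nlC => z hz; apply: nh; exists z.
  rewrite mul1r asboolT // sumr_const -mulr_natl mulr1.
  apply: le_trans hz (le_trans (base _ _ nk) _); apply: ler_sum => w wC.
  rewrite ler_nat; case: (boolP (z \in dom w)) => // zd.
  rewrite -has_count; apply/hasP; exists z; rewrite ?mem_undup //.
  exact/asboolP.
case: pselect => [h|nh] /=; last first.
  rewrite big1 ?mulr0 ?sumr_ge0 // => w wC.
  rewrite (_ : `[< _ >] = false) //; apply/asboolP; apply => z hz.
  by apply: nh; exists z.
set z := projT1 (cid h); have [nk hz] : heavy C z := projT2 (cid h).
rewrite (sum_slice _ C z).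
have step w (wC : w \in C) : (unknown_dom C w >=
    unknown_dom (slice C (ans (orc w) z)) w + (z \in dom w))%N.
  rewrite /unknown_dom; set s := undup _.
  rewrite (_ : nat_of_bool (z \in dom w) = count_mem z s); last first.
    by rewrite count_uniq_mem ?undup_uniq // mem_undup.
  rewrite -count_predUI (_ : count (predI _ _) s = 0)%N ?addn0.
    apply: sub_count => x /= /orP[/asboolP nkx|/eqP ->]; apply/asboolP => //.
    by move=> kx; apply: nkx; apply: known_sub kx; apply: slice_sub.
  apply/eqP; rewrite -leqn0 leqNgt -has_count; apply/hasPn => x xs /=.
  apply/negP => /andP[/asboolP nkx /eqP xz]; apply: nkx; rewrite xz.
  exact: known_slice.
apply: (@le_trans _ _ (\sum_(w in C) (unknown_dom (slice C (ans (orc w) z)) w +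
    (z \in dom w))%:R)); last first.
  by apply: ler_sum => w wC; rewrite ler_nat; apply: step.
under [leRHS]eq_bigr do rewrite natrD; rewrite big_split /=.
rewrite -[m.+2]addn1 natrD mulrDl mulrDl; apply: lerD; last first.
  apply: le_trans (base _ _ nk); apply: le_trans hz; rewrite mul1r ler_pM2l //.
  rewrite -(sum_slice _ C z) -sum1_card natr_sum; apply: ler_sum => w _.
  by rewrite ler_nat leq_b1.
rewrite (sum_slice _ C z) mulr_sumr; apply: ler_sum => y _.
apply: le_trans (le_trans (IH (slice C y)) _); rewrite le_eqVlt; apply/orP; left.
  apply/eqP; congr (_ * _); apply: eq_bigr => w; rewrite inE => /andP[_ /eqP wy].
  by rewrite /= -[orc w _ _]/(ans (orc w) z) wy.
by apply/eqP; apply: eq_bigr => w; rewrite inE => /andP[_ /eqP ->].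
Qed.

End Learning.

(** * Forging from a consistent world *)

Section Attack.
Variables (R : realFieldType) (M SK VK Sig : Type) (S : sig_scheme M SK VK Sig).
Variables (L q k : nat) (ms : 'I_k -> M).
Local Notation world := (world L (gen_coins S)).
Implicit Types (C : {set world}) (w : world) (z : query) (i j : 'I_k).

Definition keys w : SK * VK := run (orc w) (gen w.2).
Definition sig w j : Sig := run (orc w) (sign S (keys w).1 (ms j)).
Definition sign_queries w j : seq query :=
  trace (orc w) (gen w.2) ++ trace (orc w) (sign S (keys w).1 (ms j)).
Definition ver_queries w j : seq query :=
  trace (orc w) (ver S (keys w).2 (ms j) (sig w j)).
Definition dom j w : seq query := sign_queries w j ++ ver_queries w j.

Lemma dom_stable j w w' : w'.2 = w.2 -> agree (dom j w) (orc w) (orc w') ->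
  [/\ keys w' = keys w, sig w' j = sig w j,
      sign_queries w' j = sign_queries w j & ver_queries w' j = ver_queries w j].
Proof.
move=> e2 ag; rewrite /sign_queries /ver_queries /sig /keys e2.
have [|-> ->] := @trace_agree _ (orc w) (orc w') (gen w.2).
  by move=> z zin; apply: ag; rewrite !mem_cat zin.
have [|-> ->] := @trace_agree _ (orc w) (orc w') (sign S (keys w).1 (ms j)).
  by move=> z zin; apply: ag; rewrite !mem_cat zin orbT.
have [|-> _] // := @trace_agree _ (orc w) (orc w') (ver S (keys w).2 (ms j) (sig w j)).
by move=> z zin; apply: ag; rewrite !mem_cat zin !orbT.
Qed.

Lemma domE j w w' : w'.2 = w.2 -> agree (dom j w) (orc w) (orc w') ->
  dom j w' = dom j w.
Proof. by move=> e2 ag; rewrite /dom; have [_ _ -> ->] := dom_stable e2 ag. Qed.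

Hypothesis complete : perfectly_complete S.
Hypothesis total : forall (O : oracle) (r : (gen_coins S).-tuple bool) (m : M),
  (total_queries O r m <= q)%N.

Lemma size_dom j w : (size (dom j w) <= q)%N.
Proof.
have := total (orc w) w.2 (ms j); rewrite /total_queries /dom /sign_queries.
rewrite /ver_queries /sig /keys.
by case: (run _ _) => sk vk /=; rewrite !size_cat !size_trace.
Qed.

Lemma ver_sig j w : run (orc w) (ver S (keys w).2 (ms j) (sig w j)) = true.
Proof.
rewrite /sig; apply: (complete (O := orc w)).
by exists w.2; rewrite -/(keys w); case: (keys w).
Qed.

Definition stuck i w : bool :=
  [forall (j | j != i), has (fun z => (z \in sign_queries w i) &&
    (z \notin ver_queries w i)) (ver_queries w j)].

Lemma stuck_count w : (\sum_(i < k) stuck i w <= 'C(q, q./2))%N.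
Proof.
pose A i := mem (ver_queries w i).
pose B i := [pred z | (z \in sign_queries w i) && (z \notin ver_queries w i)].
pose s := undup (flatten [seq dom j w | j <- enum 'I_k]).
have ins j z : z \in dom j w -> z \in s.
  move=> zd; rewrite mem_undup; apply/flattenP; exists (dom j w) => //.
  by apply: map_f; rewrite mem_enum.
have h : \sum_(i | stuck i w)
    ('C(count (A i) s + count (B i) s, count (A i) s)%:R : rat)^-1 <= 1.
  apply: bollobas; first exact: undup_uniq.
    by move=> i z _ _; rewrite /A /B /= => ->; rewrite andbF.
  move=> i j /forallP si /forallP sj ij.
  have /implyP/(_ ij)/hasP[z zi /andP[z1 z2]] := sj i.
  apply/hasP; exists z; first by apply: (ins i); rewrite mem_cat zi orbT.
  by rewrite /A /B /= zi z1.
have -> : (\sum_(i < k) stuck i w)%N = #|[pred i | stuck i w]|.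
  by rewrite -sum1_card [RHS]big_mkcond; apply: eq_bigr => i _; rewrite inE; case: stuck.
have C0 : (0 < 'C(q, q./2))%N by rewrite bin_gt0; lia.
rewrite -(ler_nat rat) -[leRHS]mul1r -ler_pdivrMr ?ltr0n //; apply: le_trans h.
rewrite -sum1_card natr_sum mulr_suml; apply: ler_sum => i _.
have cs (Q : pred query) (l : seq query) : (forall z, Q z -> z \in l) ->
    (count Q s <= size l)%N.
  move=> Ql; rewrite -size_filter; apply: uniq_leq_size.
    by rewrite filter_uniq // undup_uniq.
  by move=> z; rewrite mem_filter => /andP[/Ql].
have ab : (count (A i) s + count (B i) s <= q)%N.
  apply: leq_trans (size_dom i w); rewrite size_cat addnC leq_add //.
    by apply: cs => z /andP[].
  exact: cs.
rewrite mul1r lef_pV2 ?posrE ?ltr0n // ?bin_gt0 ?leq_addr //.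
by rewrite ler_nat leq_bin_half_trans.
Qed.

(* The cap is needed because Ver may ask more than q queries on a signature that
   is not honest for the real oracle. *)
Definition attempt i (w' : world) j : oalg (option (Sig * bool)) :=
  truncate (q + q) (bind (simulate (mem (dom i w')) (orc w')
                            (sign S (keys w').1 (ms j)))
    (fun s => bind (ver S (keys w').2 (ms j) s) (fun b => Ret (s, b)))).

Definition passes i w w' j : bool :=
  if run (orc w) (attempt i w' j) is Some (_, b) then b else false.

Definition wins i w w' : bool := [exists j, (j != i) && passes i w w' j].

Lemma passesP i w w' j s : run (orc w) (attempt i w' j) = Some (s, true) ->
  s = run (splice (mem (dom i w')) (orc w) (orc w')) (sign S (keys w').1 (ms j)) /\
  run (orc w) (ver S (keys w').2 (ms j) s) = true.
Proof.
rewrite /attempt run_truncate; case: ifP => // _.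
by rewrite !run_bind /= run_simulate => -[<- ->].
Qed.

Lemma passes_intro i w w' j :
  let s := run (splice (mem (dom i w')) (orc w) (orc w')) (sign S (keys w').1 (ms j)) in
  (queries (splice (mem (dom i w')) (orc w) (orc w')) (sign S (keys w').1 (ms j)) <= q)%N ->
  (queries (orc w) (ver S (keys w').2 (ms j) s) <= q)%N ->
  run (orc w) (ver S (keys w').2 (ms j) s) = true -> passes i w w' j.
Proof.
move=> s qs qv rv; rewrite /passes /attempt run_truncate !run_bind /= run_simulate.
rewrite queries_bind run_simulate queries_bind addn0 rv ifT //.
exact: leq_add (leq_trans (queries_simulate _ _ _ _) qs) qv.
Qed.

Variable e : R.
Hypothesis e_gt0 : 0 < e.
Hypothesis e_le1 : e <= 1.

Definition same_view i C : Prop := forall w w', w \in C -> w' \in C ->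
  (keys w).2 = (keys w').2 /\ sig w i = sig w' i.

Lemma light_ver_known i C w z : same_view i C -> light (dom i) e C -> w \in C ->
  z \in ver_queries w i -> known C z.
Proof.
move=> sv lC wC zv; apply: contrapT => nkz.
have [z' nkz' h] := trace_first_diff zv nkz.
apply: (lC z'); split=> //.
rewrite (_ : asking _ _ _ = C) ?ler_piMl //.
apply/setP => w1; rewrite inE; case: (boolP (w1 \in C)) => //= w1C.
rewrite mem_cat; apply/orP; right.
have [e1 e2] := sv _ _ w1C wC; rewrite /ver_queries e1 e2.
by apply: h => y ky; apply: ky.
Qed.

Definition attack_queries w : seq query :=
  flatten [seq dom j w | j <- enum 'I_k].

Lemma size_attack_queries w : (size (attack_queries w) <= k * q)%N.
Proof.
rewrite size_flatten /shape -map_comp sumnE big_map -[k in (k * _)%N]card_ord.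
rewrite cardE -sum1_size big_distrl /=; apply: leq_sum => j _.
by rewrite mul1n size_dom.
Qed.

Definition collide i C w1 w2 : bool :=
  has (fun z => `[< ~ known C z >] && (z \in dom i w2)) (attack_queries w1).

Definition outer i (w w' : world) : pred query :=
  fun z => (z \in dom i w) || (z \in dom i w').

Lemma mix_stable i w w' : [/\ dom i (mix (outer i w w') w w') = dom i w',
  keys (mix (outer i w w') w w') = keys w',
  sign_queries (mix (outer i w w') w w') i = sign_queries w' i &
  ver_queries (mix (outer i w w') w w') i = ver_queries w' i].
Proof.
have ag : agree (dom i w') (orc w') (orc (mix (outer i w w') w w')).
  by move=> z zd; rewrite ans_mix /outer zd orbT.
by split; [apply: domE | | | ]; have [] := @dom_stable i w' (mix (outer i w w') w w') erefl ag.
Qed.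

Lemma outerC i w w' : outer i w w' = outer i w' w.
Proof. by apply/funext => z; rewrite /outer orbC. Qed.

Definition swap i (p : world * world) : world * world :=
  (mix (outer i p.1 p.2) p.1 p.2, mix (outer i p.2 p.1) p.2 p.1).

Lemma swapK i : involutive (swap i).
Proof.
have half w w' : mix (outer i (mix (outer i w w') w w') (mix (outer i w' w) w' w))
    (mix (outer i w w') w w') (mix (outer i w' w) w' w) = w.
  have [d1 _ _ _] := mix_stable i w w'; have [d2 _ _ _] := mix_stable i w' w.
  have o : outer i (mix (outer i w w') w w') (mix (outer i w' w) w' w) = outer i w w'.
    by apply/funext => z; rewrite /outer d1 d2 orbC.
  apply: world_ext => // z; rewrite o !ans_mix (outerC i w' w).
  by case: (outer i w w' z).
by move=> [w w']; rewrite /swap /= !half.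
Qed.

Lemma mix_cylinder i C w w' : cylinder (dom i) C -> w \in C -> w' \in C ->
  mix (outer i w w') w w' \in C.
Proof.
move=> cC wC w'C; apply: (cC w') => // [z zd|z kz].
  by rewrite ans_mix /outer zd orbT.
by rewrite ans_mix; case: ifP => // _; apply: kz.
Qed.

Lemma swap_wins i C w w' : same_view i C -> light (dom i) e C ->
  cylinder (dom i) C -> w \in C -> w' \in C ->
  ~~ stuck i (swap i (w, w')).1 ->
  ~~ collide i C (swap i (w, w')).1 (swap i (w, w')).2 -> wins i w w'.
Proof.
move=> sv lC cC wC w'C; rewrite /swap /=.
set D := outer i w w'; set w1 := mix D w w'; set w2 := mix _ w' w.
have [d1 k1 s1 v1] := mix_stable i w w'; have [d2 _ _ _] := mix_stable i w' w.
rewrite -/D -/w1 in d1 k1 s1 v1; rewrite -/w2 in d2.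
have w1C : w1 \in C by apply: mix_cylinder.
move=> /forallPn[j]; rewrite negb_imply => /andP[ji /hasPn free] /hasPn nc.
have nc' z : z \in dom j w1 -> z \in dom i w -> known C z.
  move=> zj zw; apply: contrapT => nk; have /nc/negP : z \in attack_queries w1.
    by apply/flattenP; exists (dom j w1) => //; apply: map_f; rewrite mem_enum.
  by apply; rewrite d2 zw andbT; apply/asboolP.
set O1 := splice (mem (dom i w')) (orc w) (orc w').
have ag1 : agree (dom j w1) (orc w1) O1.
  move=> z zj; rewrite ans_splice /w1 ans_mix /D /outer inE /=.
  case: (boolP (z \in dom i w')) => zw'; first by rewrite orbT.
  by rewrite orbF; case: ifP => // zw; apply: (nc' z zj zw).
have ag2 : agree (ver_queries w1 j) (orc w1) (orc w).
  move=> z zv; have zj : z \in dom j w1 by rewrite mem_cat zv orbT.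
  rewrite /w1 ans_mix /D /outer; case: (boolP (z \in dom i w)) => zw /=.
    exact: (nc' z zj zw).
  case: ifP => // zw'; suff kz : known C z by apply: kz.
  move: zw'; rewrite -d1 mem_cat => /orP[zs|zv']; last first.
    exact: (light_ver_known sv lC w1C zv').
  apply: (light_ver_known sv lC w1C); have := free _ zv.
  by rewrite zs /= negbK.
have [t2 r2] : trace O1 (sign S (keys w1).1 (ms j)) = trace (orc w1) (sign S (keys w1).1 (ms j))
   /\ run O1 (sign S (keys w1).1 (ms j)) = sig w1 j.
  by apply: trace_agree => z zs; apply: ag1; rewrite !mem_cat zs orbT.
have [t3 r3] := trace_agree ag2.
have sz := size_dom j w1; rewrite !size_cat in sz.
apply/existsP; exists j; rewrite ji /=; apply: passes_intro; rewrite -/O1 -k1.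
- rewrite -size_trace t2; apply: leq_trans sz.
  by rewrite -addnA; apply: leq_trans (leq_addl _ _); apply: leq_addr.
- rewrite r2 -size_trace t3; apply: leq_trans sz; exact: leq_addl.
- by rewrite r2 r3 ver_sig.
Qed.

Lemma sum_pairs C (Q : rel world) :
  #|[set p in finset.setX C C | Q p.1 p.2]| = (\sum_(w in C) \sum_(w' in C) Q w w')%N.
Proof.
rewrite pair_big /= -sum1_card big_mkcond [RHS]big_mkcond /=.
apply: eq_bigr => -[w w'] _; rewrite !inE /=.
by case: (w \in C); case: (w' \in C); case: (Q w w').
Qed.

Lemma collide_bound i C w1 : light (dom i) e C ->
  \sum_(w2 in C) (collide i C w1 w2 : nat)%:R <= (k * q)%:R * e * #|C|%:R.
Proof.
move=> lC; set s := attack_queries w1.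
apply: (@le_trans _ _ (\sum_(w2 in C) \sum_(z <- s | `[< ~ known C z >])
    ((z \in dom i w2) : nat)%:R)).
  apply: ler_sum => w2 _; rewrite /collide -/s.
  case: hasP => [[z zs /andP[nz zd]]|_] /=; last by rewrite sumr_ge0.
  rewrite (big_rem z) //= nz zd lerDl sumr_ge0 //.
rewrite exchange_big /= -mulrA.
apply: (@le_trans _ _ (\sum_(z <- s | `[< ~ known C z >]) (e * #|C|%:R))).
  apply: ler_sum => z /asboolP nz; rewrite leNgt; apply/negP => h; apply: (lC z).
  split=> //; apply: le_trans (ltW h) _.
  rewrite -sum1_card natr_sum [leLHS]big_mkcond [leRHS]big_mkcond /=.
  by apply: ler_sum => w _; rewrite inE; case: (w \in C) => //=; case: ifP.
rewrite big_const_seq iter_addr_0 -[_ *+ count _ _]mulr_natl ler_wpM2r //.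
  by rewrite mulr_ge0 // ltW.
by rewrite ler_nat (leq_trans (count_size _ _)) // size_attack_queries.
Qed.

Definition losses i C w' : nat := #|[set w in C | ~~ wins i w w']|.

Definition guess i C : option world :=
  omap (fun w0 => [arg min_(w' < w0 in C) losses i C w'])%N [pick w in C].

(* Averaging over a uniform pair of consistent worlds (w, w'), the swap turns
   "w' is a bad guess for w" into "the first world is stuck, or it queries a
   light unknown point of the second one". *)
Lemma guess_losses i C w' : same_view i C -> light (dom i) e C ->
  cylinder (dom i) C -> guess i C = Some w' ->
  (losses i C w')%:R <= #|[set w in C | stuck i w]|%:R + (k * q)%:R * e * #|C|%:R.
Proof.
move=> sv lC cC; rewrite /guess; case: pickP => //= w0 w0C [].
case: arg_minnP => // w1 w1C w1min <- {w'}.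
have C0 : 0 < #|C|%:R :> R by rewrite ltr0n; apply/card_gt0P; exists w0.
rewrite -(ler_pM2l C0).
apply: (@le_trans _ _ #|[set p in finset.setX C C | ~~ wins i p.1 p.2]|%:R).
  rewrite (sum_pairs _ (fun w w' => ~~ wins i w w')) exchange_big /= -natrM ler_nat.
  rewrite -sum_nat_const; apply: leq_sum => w2 w2C.
  apply: leq_trans (w1min _ w2C) _; rewrite /losses -sum1_card.
  rewrite big_mkcond [leqRHS]big_mkcond /=; apply: leq_sum => w _.
  by rewrite inE; case: (w \in C) => //=; case: wins.
apply: (@le_trans _ _ #|[set p in finset.setX C C | stuck i p.1 || collide i C p.1 p.2]|%:R).
  rewrite ler_nat -(card_imset _ (inv_inj (swapK i))); apply: subset_leq_card.
  apply/fintype.subsetP => _ /imsetP[[w w'] + ->].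
  rewrite !inE /= => /andP[/andP[wC w'C] nw].
  rewrite !mix_cylinder //= -[_ || _]negbK negb_or; apply: contra nw => /andP[ns nc].
  exact: (swap_wins sv lC cC wC w'C ns nc).
rewrite (sum_pairs _ (fun w w' => stuck i w || collide i C w w')) natr_sum.
apply: (@le_trans _ _ (\sum_(w in C) ((stuck i w : nat)%:R * #|C|%:R +
    (k * q)%:R * e * #|C|%:R))).
  apply: ler_sum => w wC; apply: le_trans (lerD (lexx _) (collide_bound w lC)).
  rewrite -sum1_card !natr_sum mulr_sumr -big_split /=.
  apply: ler_sum => w2 _; rewrite mulr1 -natrD ler_nat.
  by case: stuck; case: collide.
rewrite big_split /= sumr_const -[X in _ + X <= _]mulr_natl mulrDr lerD2r -mulr_suml.
rewrite mulrC ler_wpM2l // -natr_sum ler_nat -sum1_card.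
rewrite big_mkcond [leqRHS]big_mkcond /=; apply: leq_sum => w _.
by rewrite inE; case: (w \in C) => //=; case: stuck.
Qed.

Variable N : nat.
Variable i : 'I_k.

Definition prior (vk : VK) (s : Sig) : {set world} :=
  [set w | `[< (keys w).2 = vk /\ sig w i = s >]].

Definition view w : {set world} := prior (keys w).2 (sig w i).

Definition leaf w : {set world} := run (orc w) (learn (dom i) e N (view w)).

Definition won w : bool := if guess i (leaf w) is Some w' then wins i w w' else false.

Lemma view_mem w : w \in view w.
Proof. by rewrite inE; apply/asboolP. Qed.

Lemma view_class w w' : w' \in view w -> view w' = view w.
Proof. by rewrite inE => /asboolP[e1 e2]; rewrite /view e1 e2. Qed.

Lemma leaf_view w : leaf w \subset view w.
Proof. exact: learn_sub. Qed.

Lemma leaf_mem w : w \in leaf w.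
Proof. exact/learn_mem/view_mem. Qed.

Lemma leaf_class w w' : w' \in leaf w -> leaf w' = leaf w.
Proof.
move=> w'l; rewrite /leaf (view_class (fintype.subsetP (leaf_view w) _ w'l)).
exact: learn_class.
Qed.

Lemma view_cylinder w : cylinder (dom i) (view w).
Proof.
move=> w1 w2 + e3 ag _; rewrite !inE => -[e1 e2].
by have [h1 h2 _ _] := dom_stable e3 ag; rewrite h1 h2.
Qed.

Lemma leaf_cylinder w : cylinder (dom i) (leaf w).
Proof. exact/learn_cylinder/view_cylinder. Qed.

Lemma leaf_same_view w : same_view i (leaf w).
Proof.
have vw w1 : w1 \in leaf w -> (keys w1).2 = (keys w).2 /\ sig w1 i = sig w i.
  by move=> /(fintype.subsetP (leaf_view w)); rewrite inE => /asboolP.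
by move=> w1 w2 /vw[e1 e2] /vw[e3 e4]; rewrite e1 e2 e3 e4.
Qed.

Lemma ler_sum_classes (cls : world -> {set world}) (F G : world -> R) :
  (forall w, w \in cls w) -> (forall w w', w' \in cls w -> cls w' = cls w) ->
  (forall w0, \sum_(w in cls w0) F w <= \sum_(w in cls w0) G w) ->
  \sum_w F w <= \sum_w G w.
Proof.
move=> cin ccl h.
rewrite (partition_big cls xpredT) // [leRHS](partition_big cls xpredT) //=.
apply: ler_sum => c _; have [w0 /eqP cw0|nc] := pickP (fun w => cls w == c).
  have eqc : (fun w => cls w == c) =1 mem (cls w0).
    by move=> w; rewrite -cw0; apply/eqP/idP => [<-|/ccl] //; apply: cin.
  by rewrite !(eq_bigl _ _ eqc); apply: h.
by rewrite !big_pred0.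
Qed.

Lemma unlearned_count :
  N.+1%:R * e * \sum_w (`[< ~ light (dom i) e (leaf w) >] : nat)%:R <= q%:R * #|world|%:R.
Proof.
rewrite mulr_sumr mulr_natr -sumr_const.
apply: (ler_sum_classes view_mem view_class) => w0; rewrite -mulr_sumr.
apply: le_trans (le_trans (learn_exhausts (dom i) e_gt0 N (view w0)) _).
  rewrite le_eqVlt; apply/orP; left; apply/eqP; congr (_ * _).
  by apply: eq_bigr => w /view_class vw; rewrite /leaf vw.
apply: ler_sum => w _; rewrite ler_nat; apply: leq_trans (size_dom i w).
exact: leq_trans (count_size _ _) (size_undup _).
Qed.

Lemma lost_count : \sum_w (~~ won w : nat)%:R <=
  \sum_w (`[< ~ light (dom i) e (leaf w) >] : nat)%:R + \sum_w (stuck i w : nat)%:R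
  + (k * q)%:R * e * #|world|%:R :> R.
Proof.
rewrite mulr_natr -[X in _ + X]sumr_const -!big_split /=.
apply: (ler_sum_classes leaf_mem leaf_class) => w0.
set C := leaf w0.
have lfC w : w \in C -> leaf w = C by exact: leaf_class.
have kqe : 0 <= (k * q)%:R * e by rewrite mulr_ge0 // ltW.
have [lC|nlC] := pselect (light (dom i) e C); last first.
  apply: ler_sum => w wC; rewrite lfC // asboolT //=.
  rewrite -addrA; apply: le_trans (_ : 1 <= _); first by rewrite lern1 leq_b1.
  by rewrite lerDl addr_ge0.
case gC : (guess i C) => [w'|]; last first.
  move: gC; rewrite /guess; case: pickP => // /(_ w0).
  by rewrite leaf_mem.
have := guess_losses (@leaf_same_view w0) lC (@leaf_cylinder w0) gC.
rewrite -/C => h; rewrite !big_split /=; apply: le_trans (le_trans h _).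
  rewrite /losses -sum1_card natr_sum big_mkcond [leRHS]big_mkcond /=.
  apply: ler_sum => w _; rewrite !inE; case: ifP => //= wC.
  by rewrite /won lfC // gC; case: wins.
rewrite sumr_const -[X in _ <= _ + X]mulr_natr lerD2r ler_wpDl ?sumr_ge0 //.
rewrite -sum1_card natr_sum big_mkcond [leRHS]big_mkcond /=.
by apply: ler_sum => w _; rewrite !inE; case: (w \in C) => //=; case: stuck.
Qed.

Fixpoint search (w' : world) (s : Sig) (js : seq 'I_k) : oalg (M * Sig) :=
  if js isn't j :: js' then Ret (ms i, s) else
  bind (attempt i w' j) (fun o => if o is Some (s', true) then Ret (ms j, s')
                                  else search w' s js').

Definition forge (vk : VK) (s : Sig) : oalg (M * Sig) :=
  bind (learn (dom i) e N (prior vk s)) (fun C =>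
    if guess i C is Some w' then search w' s [seq j <- enum 'I_k | j != i]
    else Ret (ms i, s)).

Lemma queries_search (O : oracle) w' s js :
  (queries O (search w' s js) <= size js * (q + q))%N.
Proof.
elim: js => //= j js IH; rewrite queries_bind mulSn leq_add ?queries_truncate //.
by case: (run _ _) => [[s' []]|].
Qed.

Lemma queries_forge (O : oracle) vk s : (queries O (forge vk s) <= N + k * (q + q))%N.
Proof.
rewrite queries_bind leq_add ?queries_learn //; case: guess => //= w'.
apply: leq_trans (queries_search _ _ _ _) _; rewrite leq_mul2r; apply/orP; right.
by rewrite size_filter (leq_trans (count_size _ _)) // size_enum_ord.
Qed.

Lemma run_search w w' s js :
  (run (orc w) (search w' s js) = (ms i, s) /\ ~~ has (passes i w w') js) \/
  exists j s', [/\ j \in js, passes i w w' j,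
    run (orc w) (search w' s js) = (ms j, s') &
    run (orc w) (attempt i w' j) = Some (s', true)].
Proof.
elim: js => [|j js IH] /=; first by left.
rewrite run_bind; case ra : (run _ (attempt _ _ _)) => [[s' []]|].
- by right; exists j, s'; rewrite mem_head /passes ra.
- rewrite /passes ra /= -/(passes i w w').
  case: IH => [|[j' [s'' [h1 h2 h3 h4]]]]; first by left.
  by right; exists j', s''; rewrite inE h1 orbT.
- rewrite /passes ra /= -/(passes i w w').
  case: IH => [|[j' [s'' [h1 h2 h3 h4]]]]; first by left.
  by right; exists j', s''; rewrite inE h1 orbT.
Qed.

(* The last clause, honesty of the forged signature in some world w1, bounds the
   lengths of the queries that verifying it can make under any oracle. *)
Lemma run_forge w :
  let out := run (orc w) (forge (keys w).2 (sig w i)) in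
  (~~ won w /\ out = (ms i, sig w i)) \/
  (won w /\ exists j w1, [/\ j != i, out = (ms j, sig w1 j),
     (keys w1).2 = (keys w).2 &
     run (orc w) (ver S (keys w).2 (ms j) (sig w1 j)) = true]).
Proof.
rewrite /= /forge run_bind -/(leaf w) /won.
case gC : (guess i (leaf w)) => [w'|]; last by left.
have w'C : w' \in leaf w.
  by move: gC; rewrite /guess; case: pickP => //= w0 w0C [<-]; case: arg_minnP.
have [kw' _] := leaf_same_view w'C (leaf_mem w).
have [[-> np]|[j [s' [jin pj -> ra]]]] :=
    run_search w w' (sig w i) [seq j <- enum 'I_k | j != i].
  left; split=> //; apply: contra np => /existsP[j /andP[ji pj]].
  by apply/hasP; exists j => //; rewrite mem_filter ji mem_enum.
right; move: jin; rewrite mem_filter => /andP[ji _].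
split; first by apply/existsP; exists j; rewrite ji.
have [s'E vs'] := passesP ra; rewrite kw' in vs'.
pose w1 := mix (mem (dom i w')) w w'.
have ag : agree (dom i w') (orc w') (orc w1).
  by move=> z zd; rewrite ans_mix inE /= zd.
have [k1 _ _ _] := @dom_stable i w' w1 erefl ag.
have s1 : sig w1 j = s'.
  rewrite s'E /sig k1.
  apply: (@trace_agree _ (splice (mem (dom i w')) (orc w) (orc w')) (orc w1) _ _).2.
  by move=> z _; rewrite ans_mix ans_splice.
by exists j, w1; rewrite s1 k1 kw'.
Qed.

End Attack.

Lemma exists_le_average (R : realFieldType) (k : nat) (F : 'I_k -> R) (x : R) :
  (0 < k)%N -> \sum_i F i <= k%:R * x -> exists i, F i <= x.
Proof.
move=> k0 h; apply: contrapT => nex.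
have : k%:R * x < \sum_i F i.
  rewrite mulr_natl -[k in x *+ k]card_ord -sumr_const.
  apply: ltr_sum => [|i _].
    by apply/hasP; exists (Ordinal k0) => //; rewrite mem_index_enum.
  by rewrite ltNge; apply/negP => Fi; apply: nex; exists i.
by rewrite ltNge h.
Qed.

Section Choice.
Variables (R : realFieldType) (M SK VK Sig : Type) (S : sig_scheme M SK VK Sig).
Variables (L q k : nat) (ms : 'I_k -> M) (lambda delta : R) (N : nat).
Hypothesis complete : perfectly_complete S.
Hypothesis total : forall (O : oracle) (r : (gen_coins S).-tuple bool) (m : M),
  (total_queries O r m <= q)%N.
Hypothesis delta_gt0 : 0 < delta.
Hypothesis delta_le1 : delta <= 1.
Hypothesis k_gt0 : (0 < k)%N.
Hypothesis k_large : 'C(q, q./2)%:R <= k%:R * lambda.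
Hypothesis N_large : 4 * k%:R * q%:R * q.+1%:R <= N.+1%:R * delta ^+ 2.

(* q.+1 instead of q keeps e positive when q = 0. *)
Let e : R := delta / (2 * k%:R * q.+1%:R).

Lemma exists_good_message : exists i : 'I_k,
  \sum_(w : world L (gen_coins S)) (~~ won q ms e N i w : nat)%:R
  <= (lambda + delta) * #|world L (gen_coins S)|%:R.
Proof.
set W : R := #|_|%:R; have k0 : 0 < k%:R :> R by rewrite ltr0n.
have W0 : 0 <= W by [].
have q0 : 0 <= q%:R :> R by [].
have d0 : 0 < 2 * k%:R * q.+1%:R :> R by rewrite !mulr_gt0.
have e0 : 0 < e by rewrite divr_gt0.
have e1 : e <= 1.
  rewrite ler_pdivrMr // mul1r (le_trans delta_le1) // -!natrM ler1n.
  by rewrite !muln_gt0 k_gt0.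
have [i hi] : exists i : 'I_k,
    \sum_(w : world L (gen_coins S)) (stuck ms i w : nat)%:R <= lambda * W.
  apply: exists_le_average => //; rewrite exchange_big /= mulrA.
  apply: (le_trans _ (ler_wpM2r W0 k_large)).
  rewrite /W mulr_natr -sumr_const; apply: ler_sum => w _.
  by rewrite -natr_sum ler_nat (stuck_count _ total).
exists i. apply: le_trans (lost_count L ms complete total e0 e1 N i) _.
have := unlearned_count L ms total e0 N i.
rewrite -/W; set U := \sum_w _ => hU.
have hN : N.+1%:R * delta * U <= q%:R * W * (2 * k%:R * q.+1%:R).
  rewrite -ler_pdivrMr //; apply: le_trans hU; rewrite le_eqVlt; apply/orP; left.
  by apply/eqP; rewrite /e; ring.
have n0 : 0 < N.+1%:R * delta ^+ 2 by rewrite mulr_gt0 ?exprn_gt0.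
have hU2 : U <= delta / 2 * W.
  rewrite -(ler_pM2l n0); apply: (@le_trans _ _ (delta * (q%:R * W * (2 * k%:R * q.+1%:R)))).
    by apply: (le_trans _ (ler_wpM2l (ltW delta_gt0) hN)); rewrite expr2; lra.
  by have := ler_wpM2r (mulr_ge0 (ltW delta_gt0) W0) N_large; lra.
have hq : (k * q)%:R * e <= delta / 2.
  rewrite /e mulrA ler_pdivrMr // natrM -[q.+1%:R]natr1.
  have := mulr_ge0 (ltW k0) (ltW delta_gt0); lra.
have := ler_wpM2r W0 hq; move: hU2 hi; lra.
Qed.
End Choice.

(** * Transfer to the random oracle *)

Section Uniform.
Variables (R : realType) (d : measure_display) (Omega : measurableType d).
Variables (P : probability Omega R) (n : nat).
Variables (O : Omega -> oracle) (r : Omega -> n.-tuple bool) (c : Omega -> 0.-tuple bool).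
Hypothesis uniform : random_oracle_and_coins P O r c.
Variable L : nat.

Local Open Scope classical_set_scope.

Lemma layers_of_eq (O' : oracle) (f : layers L) :
  layers_of L O' = f <-> forall l, l \in iota 0 L -> O' l = extend f l.
Proof.
split=> [<- l|h].
  rewrite mem_iota /= add0n => lL; apply/ffunP => x.
  have := ans_extend_layers_of L O' (Tagged (fun l => l.-tuple bool) x).
  by rewrite /= lL /ans /= => ->.
apply: extend_inj => z; rewrite ans_extend_layers_of; case: ltnP => [zL|Lz].
  by rewrite /ans (h (tag z)) // mem_iota.
by rewrite ans_extend.
Qed.

Let fiber (x : world L n) : set Omega :=
  [set w | [/\ forall l, l \in iota 0 L -> O w l = extend x.1 l, r w = x.2 & c w = [tuple]]].

Lemma fiberE (x : world L n) : fiber x = [set w | (layers_of L (O w), r w) = x].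
Proof.
apply/seteqP; split=> w; rewrite /fiber /=.
  by move=> [/layers_of_eq h1 h2 _]; case: x h1 h2 => f u /= -> ->.
by move=> <-; split=> //=; [apply/layers_of_eq | rewrite tuple0].
Qed.

Lemma measurable_fiber (x : world L n) : measurable (fiber x).
Proof.
have [mO mr mc _] := uniform.
have -> : fiber x = (\bigcap_(l in [set` iota 0 L]) [set w | O w l = extend x.1 l])
    `&` [set w | r w = x.2] `&` [set w | c w = [tuple]].
  by apply/seteqP; split=> w /= [] => [h1 h2 h3|[h1 h2] h3].
apply: measurableI => //; apply: measurableI => //.
by apply: fin_bigcap_measurable => // l _.
Qed.

Lemma probability_fiber (x : world L n) : P (fiber x) = (#|world L n|%:R^-1)%:E.
Proof.
have [_ _ _ ->] := uniform; last exact: iota_uniq.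
congr (_%:E); rewrite card_prod natrM invfM.
rewrite [#|{: 0.-tuple bool}|]card_tuple expn0 invr1 mulr1; congr (_ * _).
rewrite card_dep_ffun foldrE big_map big_enum /= natr_prod prodfV; congr (_^-1).
by have -> : iota 0 L = index_iota 0 L; rewrite ?big_mkord // /index_iota subn0.
Qed.

Lemma probability_world (Q : pred (world L n)) :
  P [set w | Q (layers_of L (O w), r w)] = (#|Q|%:R / #|world L n|%:R)%:E.
Proof.
have -> : [set w | Q (layers_of L (O w), r w)] = \bigcup_(x in [set` enum Q]) fiber x.
  apply/seteqP; split=> w /=.
    by move=> Qw; exists (layers_of L (O w), r w); rewrite ?fiberE //= mem_enum.
  by move=> [x /= + ]; rewrite mem_enum => Qx; rewrite fiberE /= => ->.
rewrite measure_fin_bigcup //; first last.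
- by move=> x _; apply: measurable_fiber.
- by move=> x y _ _ [w []]; rewrite !fiberE /= => -> ->.
rewrite -fsbig_seq ?enum_uniq //.
rewrite (eq_bigr (fun=> (#|world L n|%:R^-1)%:E)) => [|x _].
  2: exact: probability_fiber.
rewrite sumEFin big_const_seq count_predT -cardE iter_addr_0.
by congr (_%:E); rewrite [RHS]mulr_natl.
Qed.

End Uniform.

Section Adversary.
Variables (R : realFieldType) (M SK VK Sig : Type) (S : sig_scheme M SK VK Sig).
Variables (L q k : nat) (ms : 'I_k -> M) (e : R) (N : nat) (i : 'I_k).

Definition honest (r : (gen_coins S).-tuple bool) (m : M) : oalg bool :=
  bind (gen r) (fun kv => bind (sign S kv.1 m) (fun s => ver S kv.2 m s)).

(* Answering the queries of length at least L itself confines the attack to the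
   finitely many layers of a world. *)
Definition forger : adversary M VK Sig :=
  @Adversary M VK Sig 0 (fun _ => ms i) (fun _ vk s =>
    simulate (fun z => (L <= tag z)%N) (fun l => [ffun x => x])
      (forge S L q ms e N i vk s)).

Hypothesis ms_inj : injective ms.
Hypothesis short : forall r j, (max_length (honest r (ms j)) <= L)%N.

Lemma ans_below (O : oracle) (r : (gen_coins S).-tuple bool) (z : query) :
  (tag z < L)%N -> ans (orc (layers_of L O, r)) z = ans O z.
Proof. by move=> zL; rewrite ans_extend_layers_of zL. Qed.

Lemma run_forger (O : oracle) (r : (gen_coins S).-tuple bool) c vk s :
  run O (@adv_forge _ _ _ forger c vk s) =
  run (orc (layers_of L O, r)) (forge S L q ms e N i vk s).
Proof.
rewrite /= run_simulate.
apply: (@trace_agree _ (orc (layers_of L O, r)) _ _ _).2 => z _.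
rewrite ans_splice ans_extend_layers_of; case: ltnP => // _.
by rewrite /ans ffunE.
Qed.

Lemma breaks_won (O : oracle) (r : (gen_coins S).-tuple bool)
    (c : (adv_coins forger).-tuple bool) :
  breaks O r c <-> won q ms e N i (layers_of L O, r).
Proof.
set w := (layers_of L O, r).
have below := @ans_below O r; rewrite -/w in below.
have bg (w1 : world L (gen_coins S)) j :
    [/\ (max_length (gen w1.2) <= L)%N,
        (max_length (sign S (keys w1).1 (ms j)) <= L)%N &
        (max_length (ver S (keys w1).2 (ms j) (sig ms w1 j)) <= L)%N].
  have [h1 h2] := max_length_bind (orc w1) (gen w1.2)
    (fun kv => bind (sign S kv.1 (ms j)) (fun s => ver S kv.2 (ms j) s)).
  have [h3 h4] := max_length_bind (orc w1) (sign S (keys w1).1 (ms j))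
    (fun s => ver S (keys w1).2 (ms j) s).
  have hL := short w1.2 j.
  by split; [apply: leq_trans h1 hL|apply: leq_trans (leq_trans h3 h2) hL|
             apply: leq_trans (leq_trans h4 h2) hL].
have [b1 b2 _] := bg w i.
have kw : keys w = run O (gen r) by apply: run_below below.
have sw : sig ms w i = run O (sign S (keys w).1 (ms i)) by apply: run_below below.
rewrite /breaks -kw; case E : (keys w) => [sk vk].
have -> : run O (sign S sk (adv_msg (a := forger) c)) = sig ms w i by rewrite sw E.
rewrite (run_forger _ r).
have := run_forge q ms e N i w; rewrite /= E /=.
move=> [[/negbTE nw ->]|[ww [j [w1 [ji -> kw1 vr]]]]].
  by rewrite nw; split=> // -[].
rewrite ww; split=> // _; split; first by move=> /ms_inj/eqP; apply/negP.
have [_ _ b3] := bg w1 j; rewrite kw1 in b3.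
by rewrite -vr; symmetry; apply: run_below below.
Qed.

End Adversary.

Lemma max_length_bounded (k : nat) (M SK VK Sig : Type) (S : sig_scheme M SK VK Sig)
    (ms : 'I_k -> M) :
  exists L, forall (r : (gen_coins S).-tuple bool) j, (max_length (honest r (ms j)) <= L)%N.
Proof.
exists (\max_(r : (gen_coins S).-tuple bool) \max_(j < k) max_length (honest r (ms j)))%N.
move=> r j; apply: leq_trans (leq_bigmax r).
exact: (leq_bigmax (F := fun j => max_length (honest r (ms j))) j).
Qed.

Local Open Scope classical_set_scope.

Lemma card_at_least_injective (R : realType) (T : Type) (x : R) :
  0 < x -> card_at_least T x ->
  exists k, exists2 ms : 'I_k -> T, injective ms & x <= k%:R < x + 1.
Proof.
move=> x0 [n [xn le_n]].
have ex : exists m : nat, x <= m%:R by exists n.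
case: (ex_minnP ex) => k xk kmin.
have kn : (k <= n)%N by exact: kmin.
have k0 : (0 < k)%N by rewrite -(ltr0n R); apply: lt_le_trans xk.
have : (`I_k #<= [set: T])%card.
  apply: card_le_trans le_n.
  by apply: subset_card_le => m /= /leq_trans; apply.
move=> /card_leP/unsquash f.
pose g (j : 'I_k) : T := val (f (SigSub (@mem_set _ `I_k (j : nat) (ltn_ord j)))).
exists k, g.
  move=> j j' /val_inj /inj h; apply/val_inj.
  have := h (in_setT _) (in_setT _).
  by move/(congr1 val).
rewrite xk /= -ltrBlDr ltNge; apply/negP => h.
have := kmin k.-1; rewrite -subn1 natrB // => /(_ h); lia.
Qed.

Lemma powR_three_halves (R : realType) (x : R) :
  0 <= x -> x `^ (3 / 2) = x * Num.sqrt x.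
Proof.
rewrite le_eqVlt => /orP[/eqP<-|x0]; first by rewrite mul0r powR0 //; lra.
have -> : (3 / 2 = 1 + 2^-1 :> R) by lra.
by rewrite powRD ?(gt_eqF x0) ?implybT // powRr1 ?powR12_sqrt ?ltW.
Qed.

Lemma bin_half_powR (R : realType) (q : nat) :
  q%:R ^+ 2 * 'C(q, q./2)%:R <= q%:R `^ (3 / 2) * 2 ^+ q :> R.
Proof.
have q0 : 0 <= q%:R :> R by [].
rewrite powR_three_halves //; set s := Num.sqrt _.
have s0 : 0 <= s by rewrite sqrtr_ge0.
have ss : s ^+ 2 = q%:R by rewrite sqr_sqrtr.
have h : s * 'C(q, q./2)%:R <= 2 ^+ q.
  rewrite -ler_sqr ?nnegrE ?mulr_ge0 ?exprn_ge0 // exprMn ss -exprM mulnC exprM.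
  rewrite -!natrX -natrM ler_nat mulnC; exact: bin_half_sqr.
rewrite expr2 -!mulrA ler_wpM2l // -{1}ss expr2 -mulrA ler_wpM2l //.
Qed.

Lemma query_budget (R : realFieldType) (q k N b : nat) (lambda delta : R) :
  0 < lambda -> lambda <= 1 -> 0 < delta -> delta <= 1 -> (0 < b)%N ->
  k%:R < b%:R / lambda + 1 ->
  N%:R <= 4 * k%:R * q%:R * q.+1%:R / delta ^+ 2 ->
  (N + k * (q + q))%:R <= 20 * (q%:R ^+ 2 * b%:R / (lambda * delta ^+ 2)).
Proof.
move=> l0 l1 d0 d1 b0 kb Nb.
have d2 : 0 < delta ^+ 2 by rewrite exprn_gt0.
have d21 : delta ^+ 2 <= 1 by rewrite exprn_ile1 // ltW.
have x1 : 1 <= b%:R / lambda by rewrite ler_pdivlMr // mul1r (le_trans l1) // ler1n.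
have q2 : (q * q.+1)%:R <= 2 * q%:R ^+ 2 :> R.
  by rewrite -natrX -natrM ler_nat -mulnn; nia.
have q1 : q%:R <= q%:R ^+ 2 :> R by rewrite -natrX ler_nat -mulnn; nia.
have q0 : 0 <= q%:R ^+ 2 :> R by rewrite sqr_ge0.
have k2 : k%:R <= 2 * (b%:R / lambda) by lra.
have k0 : 0 <= k%:R :> R by [].
have -> : 20 * (q%:R ^+ 2 * b%:R / (lambda * delta ^+ 2)) =
    20 * (b%:R / lambda) * q%:R ^+ 2 / delta ^+ 2.
  by field; rewrite !gt_eqF.
rewrite natrD natrM natrD ler_pdivlMr // mulrDl.
move: Nb; rewrite ler_pdivlMr // => Nb.
have h1 : k%:R * (q%:R + q%:R) * delta ^+ 2 <= 2 * k%:R * q%:R ^+ 2.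
  apply: (@le_trans _ _ (k%:R * (q%:R + q%:R) * 1)).
    by rewrite ler_wpM2l // mulr_ge0.
  by have := ler_wpM2l k0 q1; lra.
have h2 : 4 * k%:R * q%:R * q.+1%:R <= 8 * k%:R * q%:R ^+ 2 :> R.
  by have := ler_wpM2l k0 q2; rewrite natrM; lra.
have h3 := ler_wpM2r q0 k2.
by apply: le_trans (lerD Nb h1) _; lra.
Qed.

Theorem theorem4p1 (R : realType) :
  exists C1 C2 : R, [/\ 0 < C1, 0 < C2 &
    forall (M SK VK Sig : Type) (S : sig_scheme M SK VK Sig) (q : nat)
           (lambda delta : R),
      perfectly_complete S ->
      (forall (O : oracle) (r : (gen_coins S).-tuple bool) (m : M),
         (total_queries O r m <= q)%N) ->
      0 < lambda -> 0 < delta ->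
      card_at_least M ('C(q, q./2)%:R / lambda) ->
      exists A : adversary M VK Sig,
        [/\ forall (O : oracle) (c : (adv_coins A).-tuple bool) (vk : VK)
                   (s : Sig),
              (queries O (adv_forge c vk s))%:R
                <= C1 * (q%:R ^+ 2 * 'C(q, q./2)%:R / (lambda * delta ^+ 2)),
            q%:R ^+ 2 * 'C(q, q./2)%:R / (lambda * delta ^+ 2)
              <= C2 * ((q%:R `^ (3 / 2)) * 2 ^+ q / (lambda * delta ^+ 2)) &
            forall (d : measure_display) (Omega : measurableType d)
                   (P : probability Omega R) (O : Omega -> oracle)
                   (r : Omega -> (gen_coins S).-tuple bool)
                   (c : Omega -> (adv_coins A).-tuple bool),
              random_oracle_and_coins P O r c ->
              ((1 - (lambda + delta))%:E
                 <= P [set w | breaks (O w) (r w) (c w)])%E]].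
Proof.
exists 20, 1; split=> // M SK VK Sig S q lambda delta complete total l0 d0 cardM.
have C0 : (0 < 'C(q, q./2))%N by rewrite bin_gt0; lia.
have x0 : 0 < 'C(q, q./2)%:R / lambda by rewrite divr_gt0 ?ltr0n.
have [k [ms ms_inj /andP[xk kx]]] := card_at_least_injective x0 cardM.
have k0 : (0 < k)%N by rewrite -(ltr0n R); apply: lt_le_trans xk.
have D0 : 0 < lambda * delta ^+ 2 by rewrite mulr_gt0 ?exprn_gt0.
have budget : q%:R ^+ 2 * 'C(q, q./2)%:R / (lambda * delta ^+ 2)
    <= 1 * (q%:R `^ (3 / 2) * 2 ^+ q / (lambda * delta ^+ 2)).
  by rewrite mul1r ler_pM2r ?invr_gt0 ?bin_half_powR.
have [big|small] := leP 1 (lambda + delta).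
  exists (@Adversary M VK Sig 0 (fun _ => ms (Ordinal k0))
    (fun _ _ s => Ret (ms (Ordinal k0), s))); split=> //.
    move=> O c vk s.
    by rewrite /= mulr_ge0 // divr_ge0 ?mulr_ge0 ?exprn_ge0 // ltW.
  by move=> d Omega P O r c _; apply: (@le_trans _ _ 0%E) => //; rewrite lee_fin subr_le0.
have [L short] := max_length_bounded S ms.
pose y := 4 * k%:R * q%:R * q.+1%:R / delta ^+ 2.
have y0 : 0 <= y by rewrite divr_ge0 ?mulr_ge0 ?exprn_ge0 ?(ltW d0).
have /andP[Ny yN] := truncn_itv y0; set N := Num.trunc y in Ny yN.
have l1 : lambda <= 1 by rewrite ltW // (le_lt_trans _ small) // lerDl ltW.
have d1 : delta <= 1 by rewrite ltW // (le_lt_trans _ small) // lerDr ltW.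
have k_large : 'C(q, q./2)%:R <= k%:R * lambda by rewrite -ler_pdivrMr.
have N_large : 4 * k%:R * q%:R * q.+1%:R <= N.+1%:R * delta ^+ 2.
  by rewrite -ler_pdivrMr ?exprn_gt0 //; apply: ltW.
have [i hi] := exists_good_message L ms complete total d0 d1 k0 k_large N_large.
set e := (delta / _) in hi.
exists (forger S L q ms e N i); split=> //.
  move=> O c vk s.
  apply: le_trans (query_budget l0 l1 d0 d1 C0 kx Ny).
  rewrite ler_nat /=; apply: leq_trans (queries_simulate _ _ _ _) _.
  exact: queries_forge.
move=> d Omega P O r c unif.
have -> : [set w | breaks (O w) (r w) (c w)] =
    [set w | won q ms e N i (layers_of L (O w), r w)].
  by apply/seteqP; split=> w /=; rewrite breaks_won.
rewrite (probability_world unif) lee_fin.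
set W := #|world L (gen_coins S)|.
have W0 : 0 < W%:R :> R.
  rewrite ltr0n; apply/card_gt0P.
  by exists (layers_of L (fun l => [ffun x => x]), [tuple of nseq _ true]).
rewrite ler_pdivlMr // mulrBl mul1r lerBlDr.
apply: le_trans (lerD (lexx _) hi); rewrite -!natr_sum -natrD ler_nat.
rewrite -(sum1_card (won q ms e N i)) big_mkcond -big_split /= /W -sum1_card.
apply: leq_sum => w _; by rewrite -[w \in _]/(won q ms e N i w); case: won.
Qed.
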